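(* Let $N$ be a feed-forward network and let $L$ be a feed-forward network that is a lift of $N$ and is backward connected. Then the lift of $N$ to $L$ is the composition of a lift that creates new layers with lifts inside the layers. That is, there is a finite sequence of feed-forward networks $N=Q_0,Q_1,\dots,Q_r=L$ ($r\ge 1$) such that $Q_1$ is a lift of $Q_0$ that creates new layers (or $Q_1=Q_0$), and, for $1\le l<r$, $Q_{l+1}$ is a lift of $Q_l$ inside a layer.
   Context: A network $N$ with $k$ edge types is a finite set of cells $C$ together with functions $\sigma_1,\dots,\sigma_k:C\to C$ ($\sigma_i(c)$ is the source of the unique edge of type $i$ targeting $c$); we say $N$ is represented by $(\sigma_i)_{i=1}^k$. Networks represented by $(\sigma_i:C\to C)$ and $(\sigma_i':C'\to C')$ are equal if there is a bijection $\varphi:C\to C'$ with $\varphi\circ\sigma_i=\sigma_i'\circ\varphi$ for all $1\le i\le k$. A feed-forward network is a network whose cells can be partitioned into nonempty layers $C_0,C_1,\dots,C_m$ such that $\sigma_i(c)=c$ for every $c\in C_0$ and every $i$; $\sigma_i(C_j)\subseteq C_{j-1}$ for $1\le j\le m$ and every $i$; and for every $0\le j\le m-1$ and $c\in C_j$ there are $c'\in C_{j+1}$ and $i$ with $c=\sigma_i(c')$. Feed-forward networks are assumed connected (as undirected graphs). A network is backward connected if there is a cell $c$ such that every other cell $c'$ can be joined to $c$ by a directed path of edges from $c'$ to $c$. A coloring is an equivalence relation $\bowtie$ on the set of cells; it is balanced if $c\bowtie c'$ implies $\sigma_i(c)\bowtie\sigma_i(c')$ for all $i$. For $\bowtie$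 balanced, the quotient network $N/\bowtie$ has the $\bowtie$-classes as cells and is represented by $\sigma_i^{\bowtie}([c]_{\bowtie})=[\sigma_i(c)]_{\bowtie}$. A network $L$ is a lift of $N$ if $N=L/\bowtie$ for some balanced coloring $\bowtie$ in $L$. If $L$ is a lift of $N$ and $N$ is a lift of $Q$, then $L$ is a lift of $Q$, and the lift of $Q$ to $L$ is called the composition of the lift of $Q$ to $N$ and the lift of $N$ to $L$. Let $L$ be a feed-forward lift of a feed-forward network $N$, with layers $C'_0,\dots,C'_n$ and $C_0,\dots,C_m$ respectively. $L$ is a lift inside the layer $C_j$ ($0\le j\le m$) if $m=n$, $|C'_j|\ne|C_j|$ and $|C'_i|=|C_i|$ for $i\ne j$. $L$ is a lift that creates $n-m$ new layers if $m<n$, $|C'_0|=|C'_1|=\dots=|C'_{n-m}|=|C_0|$ and $|C'_{n-m+j}|=|C_j|$ for $1\le j\le m$. *)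

(* Defs.v *)
From HB Require Import structures.
From mathcomp Require Import all_boot.

Set Implicit Arguments.
Unset Strict Implicit.
Unset Printing Implicit Defensive.

Local Open Scope quotient_scope.

(* [src i c] is the source of the unique edge of type [i] targeting [c]. *)
Record network (k : nat) : Type := Network {
  cell :> finType;
  src : 'I_k -> cell -> cell
}.
Arguments src {k} n i c : rename.

(* Equality of networks, i.e. up to relabelling the cells. *)
Definition net_eq k (N N' : network k) : Prop :=
  exists2 phi : N -> N', bijective phi &
    forall (i : 'I_k) (c : N), phi (src N i c) = src N' i (phi c).

Definition edge k (N : network k) : rel N :=
  fun a b => [exists i : 'I_k, src N i b == a].

Definition connected k (N : network k) : Prop :=
  forall a b : N, connect (fun x y => edge x y || edge y x) a b.

Definition backward_connected k (N : network k) : Prop :=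
  exists c : N, forall c' : N, connect (@edge k N) c' c.

(* The layers are [C 0, ..., C m]; the values of [C] beyond [m] are
   irrelevant. *)
Definition layering k (N : network k) (m : nat) (C : nat -> {set N}) : Prop :=
  [/\ [/\ forall j, j <= m -> C j != set0,
          forall j j', j <= m -> j' <= m -> j != j' ->
            [disjoint C j & C j']
        & \bigcup_(j < m.+1) C j = [set: N]],
      forall (i : 'I_k) (c : N), c \in C 0 -> src N i c = c,
      forall (i : 'I_k) j (c : N), 1 <= j <= m ->
        c \in C j -> src N i c \in C j.-1
    & forall j (c : N), j < m -> c \in C j ->
        exists2 c' : N, c' \in C j.+1 & exists i : 'I_k, c = src N i c'].

Definition feed_forward k (N : network k) : Prop :=
  connected N /\ exists m (C : nat -> {set N}), layering m C.

Definition balanced k (N : network k) (e : equiv_rel N) : Prop :=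
  forall c c' : N, e c c' -> forall i : 'I_k, e (src N i c) (src N i c').

Section QuotFinite.
Variables (T : finType) (e : equiv_rel T).
HB.instance Definition _ : isFinite {eq_quot e} :=
  CanIsFinite (@reprK _ {eq_quot e}).
End QuotFinite.

(* The source maps act on representatives of the classes; for a balanced [e]
   this does not depend on the representative, see [src_quotient]. *)
Definition quotient_network k (N : network k) (e : equiv_rel N) : network k :=
  @Network k {eq_quot e} (fun i x => \pi_{eq_quot e} (src N i (repr x))).

Lemma src_quotient k (N : network k) (e : equiv_rel N) (i : 'I_k) (c : N) :
  balanced e ->
  src (quotient_network e) i (\pi_{eq_quot e} c) = \pi_{eq_quot e} (src N i c).
Proof.
move=> be; apply/eqmodP/be/eqmodP; exact: reprK.
Qed.

Definition is_lift k (L N : network k) : Prop :=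
  exists2 e : equiv_rel L, balanced e & net_eq N (quotient_network e).

Definition lift_inside_layer k (L N : network k) : Prop :=
  [/\ feed_forward L, feed_forward N, is_lift L N
    & exists n (C' : nat -> {set L}) m (C : nat -> {set N}),
      [/\ layering n C', layering m C, m = n
        & exists2 j, j <= m & #|C' j| <> #|C j| /\
            forall i, i <= m -> i <> j -> #|C' i| = #|C i|]].

Definition lift_creating_layers k (L N : network k) : Prop :=
  [/\ feed_forward L, feed_forward N, is_lift L N
    & exists n (C' : nat -> {set L}) m (C : nat -> {set N}),
      [/\ layering n C', layering m C, m < n,
          forall j, j <= n - m -> #|C' j| = #|C 0|
        & forall j, 1 <= j <= m -> #|C' (n - m + j)| = #|C j|]].

(* Main.v *)
Require Import Defs.
From mathcomp Require Import all_boot.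
From mathcomp Require Import zify.

(** Let [f : L -> N] be the quotient map and [m], [n] the numbers of the top
layers of [N], [L]. Every cell of [L] is reached backwards from one top cell,
so [f] sends layer [i] of [L] to layer [i - (n - m)] (truncated) of [N].
For a threshold [t], call two cells of [L] equivalent if they lie in the same
layer, have the same image in [N], and are equal as soon as their layer is at
least [t]. This is balanced because sources lie in lower layers. For [t > n]
the quotient is [N] with [n - m] extra copies of layer [0], for [t = 0] it is
[L], and lowering [t] to [t - 1] refines the quotient in layer [t - 1] only;
the sequence consists of the steps at which something changes. *)

Set Implicit Arguments.
Unset Strict Implicit.
Unset Printing Implicit Defensive.

Local Open Scope quotient_scope.

(** * Network morphisms and quotient networks *)

Definition net_morphism k (N N' : network k) (f : N -> N') : Prop :=
  forall (i : 'I_k) (c : N), f (src N i c) = src N' i (f c).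

Definition surjective (T U : Type) (f : T -> U) : Prop :=
  forall y, exists x, f x = y.

Section Kernel.
Variables (T : Type) (U : eqType) (f : T -> U).

Lemma ker_equiv_class : equiv_class_of (fun x y => f x == f y).
Proof.
split=> [x|x y|y x z]; rewrite ?eqxx ?[f y == f x]eq_sym //.
by move=> /eqP->.
Qed.

Definition ker_equiv : equiv_rel T := EquivRelPack ker_equiv_class.

End Kernel.

Section Quotients.
Variables (k : nat) (L : network k).

Lemma repr_quotient (e : equiv_rel L) (c : L) :
  e (repr (\pi_(quotient_network e) c)) c.
Proof. by apply/eqmodP; exact: reprK. Qed.

Lemma pi_morphism (e : equiv_rel L) :
  balanced e ->
  net_morphism (fun c : L => \pi_{eq_quot e} c : quotient_network e).
Proof. by move=> be i c; rewrite src_quotient. Qed.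

Lemma pi_surjective (e : equiv_rel L) :
  surjective (fun c : L => \pi_{eq_quot e} c : quotient_network e).
Proof. by move=> x; exists (repr x); exact: reprK. Qed.

(** The projection to the quotient, followed by the inverse relabelling, is the map; lifts are
    handled as surjective morphisms from here on. *)
Lemma is_lift_morphism (N : network k) :
  is_lift L N -> exists2 f : L -> N, net_morphism f & surjective f.
Proof.
move=> [e be [phi [psi phiK psiK] phiM]].
exists (fun c => psi (\pi_{eq_quot e} c)) => [i c|y].
  by apply: (can_inj phiK); rewrite phiM !psiK src_quotient.
by exists (repr (phi y)); rewrite reprK phiK.
Qed.

(** First isomorphism theorem: the balanced coloring is the kernel of [f]. *)
Lemma morphism_is_lift (N : network k) (f : L -> N) :
  net_morphism f -> surjective f -> is_lift L N.
Proof.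
move=> fM fS; pose e := ker_equiv f.
have be : balanced e.
  by move=> c c' /eqP fcc' i; apply/eqP; rewrite !fM fcc'.
have fE (x : N) : exists c, f c == x by have [c <-] := fS x; exists c.
exists e => //; exists (fun x => \pi_{eq_quot e} (xchoose (fE x))).
  exists (fun q : quotient_network e => f (repr q)) => [x|q].
    have /eqP-> := repr_quotient e (xchoose (fE x)).
    exact: (eqP (xchooseP (fE x))).
  rewrite -[RHS]reprK; apply/eqmodP; exact: (xchooseP (fE (f (repr q)))).
move=> i x; rewrite src_quotient //; apply/eqmodP/eqP.
by rewrite fM (eqP (xchooseP (fE _))) (eqP (xchooseP (fE _))).
Qed.

Lemma connected_image (N : network k) (f : L -> N) :
  net_morphism f -> surjective f -> connected L -> connected N.
Proof.
move=> fM fS cL a b; have [x <-] := fS a; have [y <-] := fS b.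
have fe u v : edge u v -> edge (f u) (f v).
  by move=> /existsP[i /eqP<-]; apply/existsP; exists i; rewrite fM.
have /connectP[p] := cL x y; elim: p x => [|z p IH] x /= => [_ ->|].
  exact: connect0.
move=> /andP[xz /IH{}IH /IH]; apply: connect_trans; apply: connect1.
by case/orP: xz => /fe ->; rewrite ?orbT.
Qed.

Lemma quotient_lift (e e' : equiv_rel L) :
  balanced e -> balanced e' -> subrel e e' ->
  let f (x : quotient_network e) : quotient_network e' :=
    \pi_{eq_quot e'} (repr x) in
  net_morphism f /\ surjective f.
Proof.
move=> be be' ee' f; split=> [i x|y].
  rewrite src_quotient //; apply/eqmodP/ee'; exact: repr_quotient.
exists (\pi_{eq_quot e} (repr y)); rewrite /f -[RHS]reprK.
by apply/eqmodP/ee'; exact: repr_quotient.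
Qed.

Lemma quotient_discrete (e : equiv_rel L) :
  (forall x y, e x y -> x = y) -> net_eq (quotient_network e) L.
Proof.
move=> e_eq; exists (fun x : quotient_network e => repr x).
  by exists (\pi_{eq_quot e}) => c; [exact: reprK | apply/e_eq/repr_quotient].
by move=> i c; apply/e_eq/repr_quotient.
Qed.

End Quotients.

(** * Layerings encoded as functions *)

Section Layers.
Variable k : nat.

(** One index per cell makes the partition automatic, and the truncated predecessor lets the source
    clause hold in layer [0] too. *)
Definition layer_function (N : network k) (m : nat) (lay : N -> nat) : Prop :=
  [/\ forall c, lay c <= m,
      forall j, j <= m -> exists c, lay c = j,
      forall (i : 'I_k) c, lay (src N i c) = (lay c).-1,
      forall (i : 'I_k) c, lay c = 0 -> src N i c = c
    & forall c, lay c < m ->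
        exists2 c', lay c' = (lay c).+1 & exists i : 'I_k, c = src N i c'].

Lemma layering_function (N : network k) m (C : nat -> {set N}) :
  layering m C -> exists lay : N -> nat, layer_function m lay.
Proof.
move=> [[C_ne C_disj C_cov] C0 CS C_src].
have lay_ex c : exists j : 'I_m.+1, c \in C j.
  have : c \in \bigcup_(j < m.+1) C j by rewrite C_cov inE.
  by case/bigcupP=> j _ cj; exists j.
pose lay c : nat := xchoose (lay_ex c).
have layP c : c \in C (lay c) := xchooseP (lay_ex c).
have lay_le c : lay c <= m by rewrite /lay -ltnS.
have layE j c : j <= m -> c \in C j -> lay c = j.
  move=> jm cj; apply/eqP/negPn/negP => ne.
  have /disjointFr/(_ (layP c)) := C_disj _ _ (lay_le c) jm ne.
  by rewrite cj.
exists lay; split=> //.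
- by move=> j jm; have /set0Pn[c cj] := C_ne _ jm; exists c; exact: layE.
- move=> i c; have := layP c; have := lay_le c.
  case: (lay c) => [_ c0|j jm cj] /=; first by rewrite C0 // (layE 0).
  by apply: layE; [exact: ltnW | exact: (CS i j.+1)].
- by move=> i c c0; apply: C0; rewrite -c0.
- move=> c cm; have [c' c'S ci] := C_src _ _ cm (layP c).
  by exists c'; first exact: layE.
Qed.

Lemma function_layering (N : network k) m (lay : N -> nat) :
  layer_function m lay -> layering m (fun j => [set c | lay c == j]).
Proof.
move=> [lay_le lay_ne layS lay0 lay_src]; split; first split.
- move=> j /lay_ne[c cj]; apply/set0Pn; exists c; by rewrite inE cj.
- move=> j j' _ _ ne; apply/pred0P => c /=; rewrite !inE.
  by apply/negP => /andP[/eqP-> /eqP jj']; rewrite jj' eqxx in ne.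
- apply/setP => c; rewrite inE; apply/bigcupP.
  have cm : lay c < m.+1 by rewrite ltnS.
  by exists (Ordinal cm); rewrite ?inE.
- by move=> i c; rewrite inE => /eqP/lay0.
- by move=> i j c _; rewrite !inE layS => /eqP->.
- move=> j c jm; rewrite inE => /eqP cj; rewrite -cj in jm *.
  by have [c' c'S ci] := lay_src _ jm; exists c'; rewrite ?inE ?c'S.
Qed.

Lemma layer_card_morphism (A B : finType) (f : A -> B) (layA : A -> nat)
    (layB : B -> nat) i j :
  (forall x, layA x = i -> layB (f x) = j) ->
  (forall y, layB y = j -> exists2 x, layA x = i & f x = y) ->
  (forall x y, layA x = i -> layA y = i -> f x = f y -> x = y) ->
  #|[set x | layA x == i]| = #|[set y | layB y == j]|.
Proof.
move=> fij fS fI.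
rewrite -(card_in_imset (f := f)); last first.
  by move=> x y; rewrite !inE => /eqP xi /eqP yi; exact: fI.
congr #|pred_of_set _|; apply/setP => y; rewrite inE; apply/imsetP/eqP.
  by move=> [x + ->]; rewrite inE => /eqP/fij.
by move=> /fS[x xi <-]; exists x; rewrite ?inE ?xi.
Qed.

(** * Quotients by colorings that respect the layers *)

Section Quotient.
Variables (L : network k) (n : nat) (lay : L -> nat).
Hypotheses (cL : connected L) (layL : layer_function n lay).

Definition qlay (e : equiv_rel L) (x : quotient_network e) : nat :=
  lay (repr x).

Definition layered (e : equiv_rel L) : Prop :=
  balanced e /\ forall x y, e x y -> lay x = lay y.

Lemma qlay_pi e c : layered e ->
  qlay (\pi_{eq_quot e} c : quotient_network e) = lay c.
Proof. by move=> [_ le]; apply/le/repr_quotient. Qed.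

Lemma quotient_layer_function e :
  layered e -> layer_function n (@qlay e).
Proof.
move=> le; have [be _] := le.
have [lay_le lay_ne layS lay0 lay_src] := layL.
split.
- by move=> c; exact: lay_le.
- move=> j /lay_ne[c cj].
  by exists (\pi_{eq_quot e} c); rewrite qlay_pi.
- by move=> i c; rewrite qlay_pi.
- by move=> i c /lay0 c0 /=; rewrite c0 reprK.
- move=> c /lay_src[c' c'S [i ci]].
  exists (\pi_{eq_quot e} c'); first by rewrite qlay_pi.
  by exists i; rewrite src_quotient // -ci reprK.
Qed.

Lemma quotient_feed_forward e : layered e -> feed_forward (quotient_network e).
Proof.
move=> le; split.
  by apply: connected_image (pi_morphism le.1) (@pi_surjective _ _ e) cL.
exists n, (fun j => [set c | qlay c == j] : {set quotient_network e}).
exact/function_layering/quotient_layer_function.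
Qed.

(** The induced surjection preserves layers and is injective off layer [j]. Equal sizes in layer [j]
    would make it injective there too, so [e'] would refine [e]. *)
Lemma quotient_inside_layer (e e' : equiv_rel L) j :
  layered e -> layered e' -> j <= n -> subrel e e' ->
  (forall x y, lay x <> j -> e' x y -> e x y) ->
  ~~ [forall x, forall y, e' x y ==> e x y] ->
  lift_inside_layer (quotient_network e) (quotient_network e').
Proof.
move=> le le' jn ee' e'e ne.
have [fM fS] := quotient_lift le.1 le'.1 ee'.
set f := fun x => _ in fM fS.
have flay x : qlay (f x) = qlay x by exact: qlay_pi.
have fI x y : f x = f y <-> e' (repr x) (repr y).
  by split=> /eqmodP.
split; [exact: quotient_feed_forward..| exact: morphism_is_lift fM fS |].
exists n, (fun j => [set c | qlay c == j]), n, (fun j => [set c | qlay c == j]).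
split=> //; try exact/function_layering/quotient_layer_function.
exists j => //; split.
  move=> card_eq; case/negP: ne; apply/forallP => x; apply/forallP => y.
  apply/implyP => exy; have [xj|/eqP xj] := eqVneq (lay x) j; last exact: e'e.
  have fj : f @: [set c | qlay c == j] = [set c | qlay c == j].
    apply/setP => z; rewrite inE; apply/imsetP/eqP.
      by move=> [u + ->]; rewrite inE flay => /eqP.
    by have [u <-] := fS z; rewrite flay => uj; exists u; rewrite ?inE ?uj.
  have /imset_injP inj : #|f @: [set c | qlay c == j]|
      == #|[set c : quotient_network e | qlay c == j]|.
    by rewrite fj card_eq.
  apply/eqmodP; apply: inj; rewrite ?inE ?qlay_pi ?xj //.
    by rewrite -(le'.2 _ _ exy) xj.
  apply/eqmodP.
  have e'r z : e' (repr (\pi_{eq_quot e} z)) z by apply/ee'/repr_quotient.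
  apply: equiv_trans (e'r x) _; apply: equiv_trans exy _.
  by rewrite equiv_sym e'r.
move=> i im ij; apply: (@layer_card_morphism _ _ f).
- by move=> x; rewrite flay.
- by move=> y; have [x <-] := fS y; rewrite flay; exists x.
- move=> x y xi yi /fI exy; rewrite -[x]reprK -[y]reprK; apply/eqmodP.
  by apply: e'e => //; rewrite -/(qlay x) xi.
Qed.

End Quotient.

Lemma positive_layer_type (N : network k) m (lay : N -> nat) :
  layer_function m lay -> 0 < m -> inhabited 'I_k.
Proof.
move=> [_ lay_ne _ _ lay_src] m0; have [c c0] := lay_ne 0 isT.
by rewrite -c0 in m0; have [_ _ [i _]] := lay_src _ m0; split.
Qed.

(** * Layers under a backward connected lift *)

Section Lift.
Variables (L N : network k) (n m : nat) (layL : L -> nat) (layN : N -> nat).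
Variables (f : L -> N) (top : L).
Hypotheses (LL : layer_function n layL) (LN : layer_function m layN).
Hypotheses (fM : net_morphism f) (fS : surjective f).
Hypothesis topP : forall c, connect (@edge k L) c top.

(** A path from [c] to [top] exhibits [c] as an iterated source of [top]. *)
Lemma backward_ind (P : L -> Prop) :
  P top -> (forall i c, P c -> P (src L i c)) -> forall c, P c.
Proof.
move=> P0 PS c; have /connectP[p] := topP c.
elim: p c => [|y p IH] c /= => [_ <- //|/andP[/existsP[i /eqP<-]] yp tp].
exact/PS/IH.
Qed.

(** Sources never raise the layer, so [top] bounds all layers, including that of a cell in layer
    [n]. *)
Lemma layer_top : layL top = n.
Proof.
have [lay_le lay_ne layS _ _] := LL.
have [c cn] := lay_ne n (leqnn n); apply/eqP; rewrite eqn_leq lay_le /= -{1}cn.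
by move: c {cn}; apply: backward_ind => /= [|i c]; rewrite ?layS; lia.
Qed.

Lemma layer_image_top : layN (f top) = m.
Proof.
have [lay_le lay_ne layS _ _] := LN.
have [b bm] := lay_ne m (leqnn m); have [c cb] := fS b.
apply/eqP; rewrite eqn_leq lay_le /= -{1}bm -cb.
by move: c {cb}; apply: backward_ind => /= [|i c]; rewrite ?fM ?layS; lia.
Qed.

Lemma layer_image_le c : layN (f c) <= layL c.
Proof.
have [_ _ layLS layL0 _] := LL; have [lay_le _ layNS _ _] := LN.
have [j] := ubnP (layL c); elim: j c => // j IH c cj.
case: (posnP (layN (f c))) => [-> //|fc0].
have [i] := positive_layer_type LN (leq_trans fc0 (lay_le _)).
have := layNS i (f c); rewrite -fM.
(* A cell in layer [0] is fixed by its sources, hence so is its image, which then cannot lie in a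
   positive layer. *)
case: (posnP (layL c)) => [/layL0 -> | c0]; first by lia.
have := IH (src L i c); rewrite layLS; lia.
Qed.

Lemma layers_le : m <= n.
Proof. by rewrite -layer_top -layer_image_top layer_image_le. Qed.

(** Both sides agree at [top], and passing to a source applies the truncated predecessor to each. *)
Lemma layer_image c : layN (f c) = layL c - (n - m).
Proof.
have [_ _ layLS _ _] := LL; have [_ _ layNS _ _] := LN.
move: c; apply: backward_ind => [|i c IH].
  by rewrite layer_top layer_image_top; have := layers_le; lia.
rewrite fM layLS layNS IH; lia.
Qed.

Lemma layer_image_surj (a : N) j :
  layN a = j - (n - m) -> j <= n ->
  exists2 c, layL c = j & f c = a.
Proof.
have [_ _ layLS _ _] := LL; have [_ _ layNS layN0 layN_src] := LN.
have mn := layers_le.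
(* First a preimage in the highest possible layer. For [a] in a positive layer any preimage
   works. *)
have high : exists2 c, layL c = layN a + (n - m) & f c = a.
  case: (posnP (layN a)) => [a0|a0]; last first.
    have [c fc] := fS a; exists c => //.
    by have := layer_image c; rewrite fc; lia.
  (* If [m] is [0], sources fix every cell of [N], so [f] is constant. Otherwise [a] is a source of
     a cell in layer [1], and the same source of a preimage of that cell lies in layer [n - m]. *)
  case: (posnP m) => [m0|m0].
    exists top; first by rewrite layer_top; lia.
    have [c <-] := fS a; move: c; apply: backward_ind => // i c ->.
    rewrite fM layN0 // layer_image; have [lay_le _ _ _ _] := LL.
    by have := lay_le c; lia.
  have [a' a'1 [i ai]] : exists2 c', layN c' = (layN a).+1 &
    exists i : 'I_k, a = src N i c' by apply: layN_src; rewrite a0.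
  have [c' fc'] := fS a'; exists (src L i c'); last by rewrite fM fc'.
  by have := layer_image c'; rewrite layLS fc'; lia.
move=> aj jn; case: (leqP (n - m) j) => [mj|jm].
  by case: high => c; exists c => //; lia.
have a0 : layN a = 0 by lia.
have [i] := positive_layer_type LL ltac:(lia).
(* Each source step goes down one layer and keeps the image [a], which is fixed. *)
have low d : exists2 c, layL c = n - m - d & f c = a.
  elim: d => [|d [c cd fc]]; first by case: high => c; exists c => //; lia.
  by exists (src L i c); rewrite ?layLS ?fM ?fc ?layN0 //; lia.
by have [c cj fc] := low (n - m - j); exists c => //; lia.
Qed.

(** * Threshold colorings and the chain of quotients *)

Definition threshold_key (t : nat) (c : L) : nat * N * option L :=
  (layL c, f c, if t <= layL c then Some c else None).

(** As a kernel this is an equivalence by construction; the option component separates cells only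
    from layer [t] upwards. *)
Definition threshold_equiv t : equiv_rel L := ker_equiv (threshold_key t).

Lemma threshold_equivP t x y :
  reflect [/\ layL x = layL y, f x = f y & t <= layL x -> x = y]
    (threshold_equiv t x y).
Proof.
apply: (iffP eqP) => [[-> ->]|[xy fxy txy]]; last first.
  by rewrite /threshold_key -xy fxy; case: leqP => // /txy ->.
by case: leqP => // _ [->].
Qed.

Lemma threshold_layered t : layered layL (threshold_equiv t).
Proof.
have [_ _ layS lay0 _] := LL.
split=> [x y /threshold_equivP[xy fxy txy] i|x y /threshold_equivP[] //].
apply/threshold_equivP; rewrite !layS !fM xy fxy; split=> // ty.
by rewrite txy // xy; lia.
Qed.

Definition threshold_net t : network k := quotient_network (threshold_equiv t).

Hypotheses (ffN : feed_forward N) (cL : connected L).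

(** No layer reaches [n.+1], so classes are determined by layer and image, and [f] induces a
    bijection of layer [i] onto layer [i - (n - m)]. *)
Lemma threshold_net_top :
  lift_creating_layers (threshold_net n.+1) N \/ net_eq (threshold_net n.+1) N.
Proof.
have [layL_le _ _ _ _] := LL.
have le := threshold_layered n.+1.
set e := threshold_equiv n.+1 in le *.
pose g (x : threshold_net n.+1) : N := f (repr x).
have g_pi c : g (\pi_{eq_quot e} c) = f c.
  by have /threshold_equivP[] := repr_quotient e c.
have gM : net_morphism g by move=> i x; rewrite g_pi fM.
have gS : surjective g.
  by move=> y; have [c <-] := fS y; exists (\pi_{eq_quot e} c).
have gI x y : qlay layL x = qlay layL y -> g x = g y -> x = y.
  move=> xy gxy; rewrite -[x]reprK -[y]reprK; apply/eqmodP/threshold_equivP.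
  by split=> //; have := layL_le (repr x); lia.
have mn := layers_le.
have cardQ i j : i <= n -> j = i - (n - m) ->
    #|[set x : threshold_net n.+1 | qlay layL x == i]|
      = #|[set y | layN y == j]|.
  move=> i_n ->; apply: (@layer_card_morphism _ _ g).
  - by move=> x xi; rewrite layer_image -xi.
  - move=> y yj; have [c ci fc] := layer_image_surj yj i_n.
    by exists (\pi_{eq_quot e} c); rewrite ?qlay_pi ?g_pi.
  - by move=> x y xi yi; apply: gI; rewrite xi.
case: (ltngtP m n) mn => // [mn _|mn _]; [left|right].
  split=> //; [exact: quotient_feed_forward cL LL _ le
              |exact: morphism_is_lift gM gS |].
  exists n, (fun j => [set c | qlay layL c == j]).
  exists m, (fun j => [set c | layN c == j]).
  split=> //.
  - exact/function_layering/quotient_layer_function.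
  - exact: function_layering.
  - by move=> j jn; apply: cardQ; lia.
  - by move=> j jn; apply: cardQ; lia.
(* With [m = n] the image alone determines the layer. *)
have gI' : injective g.
  move=> x y gxy; apply: gI => //; rewrite /qlay.
  by have := layer_image (repr x); rewrite -/(g x) gxy layer_image mn; lia.
exists g => //; have gE (y : N) : exists x, g x == y.
  by have [x <-] := gS y; exists x.
exists (fun y => xchoose (gE y)) => [x|y].
  by apply: gI'; exact: (eqP (xchooseP (gE (g x)))).
exact: (eqP (xchooseP (gE y))).
Qed.

(** Thresholds that leave the coloring unchanged are skipped, since a lift inside a layer must
    change its size. Hence [s r] may differ from [t] and only the colorings are compared. *)
Lemma threshold_chain t : t <= n.+1 ->
  exists r (s : nat -> nat),
    [/\ 1 <= r, s 1 = n.+1,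
        threshold_equiv (s r) =2 threshold_equiv t
      & forall l, 1 <= l < r ->
          lift_inside_layer (threshold_net (s l.+1)) (threshold_net (s l))].
Proof.
(* Induction on the distance of [t] below [n.+1]. *)
move=> tn; rewrite -(subKn tn); elim: (n.+1 - t) (leq_subr t n.+1) => [|d IH] dn.
  by exists 1, (fun=> n.+1); split=> //; case=> [|[]].
have [r [s [r1 s1 sr chain]]] := IH (ltnW dn).
set u := n.+1 - d in sr; set v := n.+1 - d.+1.
have uv : u = v.+1 by lia.
have sub : subrel (threshold_equiv v) (threshold_equiv u).
  move=> x y /threshold_equivP[? ? h]; apply/threshold_equivP; split=> // ?.
  by apply: h; lia.
have [same|diff] := boolP [forall x, forall y,
    threshold_equiv (s r) x y ==> threshold_equiv v x y].
  exists r, s; split=> // x y; apply/idP/idP => [|/sub]; last by rewrite sr.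
  by move/forallP/(_ x)/forallP/(_ y)/implyP: same; apply.
exists r.+1, (fun l => if l == r.+1 then v else s l); rewrite eqxx.
split=> //; first by case: eqP => //; lia.
move=> l /andP[l1]; rewrite ltnS leq_eqVlt => /orP[/eqP->|lr]; last first.
  by rewrite eqSS !ltn_eqF ?ltnS ?(ltnW lr) //; apply: chain; rewrite l1.
rewrite eqxx ltn_eqF //.
(* The thresholds [v] and [v.+1] impose different conditions in layer [v] only. *)
apply: (quotient_inside_layer (j := v) cL LL) diff.
- exact: threshold_layered.
- exact: threshold_layered.
- lia.
- by move=> x y /sub; rewrite sr.
- move=> x y xv; rewrite sr => /threshold_equivP[xy fxy h].
  by apply/threshold_equivP; split=> // ?; apply: h; lia.
Qed.

End Lift.
End Layers.

Theorem proposition3p1 (k : nat) (N L : network k) :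
  feed_forward N -> feed_forward L -> is_lift L N -> backward_connected L ->
  exists (r : nat) (Q : nat -> network k),
    1 <= r /\
    net_eq N (Q 0) /\
    net_eq (Q r) L /\
    (forall l : nat, l <= r -> feed_forward (Q l)) /\
    (lift_creating_layers (Q 1) (Q 0) \/ net_eq (Q 1) (Q 0)) /\
    (forall l : nat, 1 <= l < r -> lift_inside_layer (Q l.+1) (Q l)).
Proof.
move=> ffN [cL [n [CL /layering_function[layL LL]]]] /is_lift_morphism[f fM fS].
move=> [top topP].
have [_ [m [CN /layering_function[layN LN]]]] := ffN.
have [r [s [r1 s1 sr chain]]] :=
  threshold_chain LL fM cL (leq0n n.+1).
(* Index [0] is [N] itself; the threshold quotients start at index [1]. *)
exists r, (fun l => if l is 0 then N else threshold_net layL f (s l)).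
split=> //; split; first by exists id => //; exists id.
(* The final coloring is that of threshold [0], which is equality. *)
split; first case: r r1 sr {chain} => // r _ sr.
  apply: quotient_discrete => x y; rewrite sr => /threshold_equivP[_ _].
  exact.
split.
  case=> // l _; apply: (quotient_feed_forward cL LL).
  exact: threshold_layered LL fM _.
split; first by rewrite s1; exact: threshold_net_top LL LN fM fS topP ffN cL.
by case=> // l; exact: chain.
Qed.
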